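(* Let $\mathscr A$ be a (not necessarily commutative) unital complex Banach algebra. Suppose $A=(a_{ij})\in GL_n(\mathscr A)$, $n\ge 2$, is an (upper or lower) triangular matrix with the product of diagonal elements $a_{11}\cdots a_{nn}=1$. Then for every $\varepsilon>0$ there are matrices $B_1,B_2\in M_n(\mathscr A)$ such that \[ A=\exp B_1\cdot\exp B_2,\qquad \sigma_n(\exp B_1)=S_n,\qquad \sigma_n(\exp B_2)\subset N_\varepsilon . \]
   Context: $M_n(\mathscr A)$ is the unital complex Banach algebra of $n\times n$ matrices over $\mathscr A$, regarded as $\mathscr A$-linear operators on $\mathscr A^n$ with the operator norm, where $\|(a_1,\dots,a_n)\|_{\mathscr A^n}:=\max_i\|a_i\|_{\mathscr A}$; $GL_n(\mathscr A)$ is its group of invertible elements; $\exp B:=\sum_{i\ge 0}\frac1{i!}B^i$. $\sigma_n(A)\subset\mathbb C$ denotes the spectrum of $A$ in $M_n(\mathscr A)$. $S_n\subset\mathbb C$ is the set of roots of order $n$ of $1$, i.e. $S_n=\{z\in\mathbb C: z^n=1\}$, and $N_\varepsilon=\{z\in\mathbb C:\min_{y\in S_n}|z-y|\le\varepsilon\}$ is its closed $\varepsilon$-neighbourhood.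
   Formalization: In the lower triangular case the diagonal elements a_11,…,a_nn are additionally assumed invertible in the algebra (automatic in the upper triangular case); without this the claim fails for some noncommutative Banach algebras. *)

(* Defs.v *)
From HB Require Import structures.
From mathcomp Require Import all_boot all_order all_algebra.
From mathcomp Require Export complex.
From mathcomp Require Import all_classical all_reals all_analysis.

Set Implicit Arguments.
Unset Strict Implicit.
Unset Printing Implicit Defensive.

Import Order.TTheory GRing.Theory Num.Theory.
Import numFieldNormedType.Exports.

Local Open Scope classical_set_scope.
Local Open Scope ring_scope.

(* Joining NormedModule with GRing.Algebra in one HB structure is rejected (the
   library has no join of normed modules and rings below Num.NumDomain), so the
   multiplication is axiomatized over a complete normed module, and the
   GRing.Algebra structure is declared on the result. *)
HB.mixin Record CompleteNormedModule_isBanachAlgebra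
    (K : numFieldType) T & CompleteNormedModule K T := {
  banach_one : T;
  banach_mul : T -> T -> T;
  banach_mulA : associative banach_mul;
  banach_mul1x : left_id banach_one banach_mul;
  banach_mulx1 : right_id banach_one banach_mul;
  banach_mulDl : left_distributive banach_mul +%R;
  banach_mulDr : right_distributive banach_mul +%R;
  banach_scaleAl : forall (k : K) (x y : T),
    k *: banach_mul x y = banach_mul (k *: x) y;
  banach_scaleAr : forall (k : K) (x y : T),
    k *: banach_mul x y = banach_mul x (k *: y);
  banach_norm1 : `|banach_one| = 1;
  banach_normM : forall x y : T, `|banach_mul x y| <= `|x| * `|y|
}.

#[short(type="banachAlgType")]
HB.structure Definition BanachAlgebra (K : numFieldType) :=
  {T of CompleteNormedModule K T & CompleteNormedModule_isBanachAlgebra K T}.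

Section BanachAlgebraTheory.
Variables (K : numFieldType) (T : banachAlgType K).

Let banach_one_neq0 : banach_one != 0 :> T.
Proof. by rewrite -normr_gt0 banach_norm1 ltr01. Qed.

HB.instance Definition _ := GRing.Zmodule_isNzRing.Build T
  (@banach_mulA K T) (@banach_mul1x K T) (@banach_mulx1 K T)
  (@banach_mulDl K T) (@banach_mulDr K T) banach_one_neq0.

HB.instance Definition _ :=
  GRing.LSemiModule_isLSemiAlgebra.Build K T (@banach_scaleAl K T).

HB.instance Definition _ :=
  GRing.LSemiAlgebra_isSemiAlgebra.Build K T (@banach_scaleAr K T).

End BanachAlgebraTheory.

Section MatrixBanachAlgebra.
Variables (R : realType) (𝒜 : banachAlgType R[i]) (n : nat).
Implicit Types (M B : 'M[𝒜]_n) (v : 'cV[𝒜]_n).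

(* MathComp-Analysis norms take their values in the field of scalars, here
   R[i]; they are nonnegative, hence equal to their real part. *)
Definition vec_norm v : R := \big[Num.max/0]_(i < n) complex.Re `|v i 0|.

Definition op_norm M : R :=
  sup [set vec_norm (M *m v) | v in [set v | vec_norm v <= 1]].

(* [unitmx] is only available over commutative rings. *)
Definition mx_GL : set 'M[𝒜]_n :=
  [set M | exists N : 'M[𝒜]_n, M *m N = 1%:M /\ N *m M = 1%:M].

(* The library only lets 𝒜 scale 'M[𝒜]_n, so the complex scalar c acts as
   the central element c%:A of 𝒜. *)
Definition mx_spectrum M : set R[i] :=
  [set lambda | ~ mx_GL ((lambda%:A)%:M - M)].

Definition mx_exp_partial B (N : nat) : 'M[𝒜]_n :=
  \sum_(0 <= k < N) ((k`!%:R^-1 : R[i])%:A : 𝒜) *: (B ^+ k).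

(* The sum of the exponential series for the operator norm. The topology that
   the library puts on 'M[𝒜]_n is not used. *)
Definition mx_exp B : 'M[𝒜]_n :=
  xget 0 [set E | op_norm (E - mx_exp_partial B N) @[N --> \oo] --> (0 : R)].

End MatrixBanachAlgebra.

Definition roots_of_unity (R : realType) (n : nat) : set R[i] :=
  [set z | z ^+ n = 1].
Arguments roots_of_unity : clear implicits.

Definition roots_of_unity_nbhd (R : realType) (n : nat) (eps : R) : set R[i] :=
  [set z | exists2 y, roots_of_unity R n y & `|z - y| <= eps%:C%C].
Arguments roots_of_unity_nbhd : clear implicits.

Definition upper_triangular (T : nmodType) (n : nat) (M : 'M[T]_n) : Prop :=
  forall i j : 'I_n, (j < i)%N -> M i j = 0.

Definition lower_triangular (T : nmodType) (n : nat) (M : 'M[T]_n) : Prop :=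
  forall i j : 'I_n, (i < j)%N -> M i j = 0.

(* An invertible triangular matrix over a noncommutative ring can have
   non-invertible diagonal entries: if t * s = 1 then the lower triangular
   [[t, 0], [1 - s * t, s]] has inverse [[s, 1 - s * t], [0, t]]. *)
Definition two_sided_unit (T : pzRingType) (x : T) : Prop :=
  exists y : T, x * y = 1 /\ y * x = 1.

(* Main.v *)
(* Let P be the cyclic permutation matrix and D the diagonal part of A.
   Conjugating A by a diagonal scalar matrix makes its off-diagonal part as
   small as we like, and because the product of the diagonal entries is 1 there
   is a diagonal S with D = (S P S^-1) P^-1. Hence, up to conjugation,
   A = (S P S^-1) Q with Q close to P^-1. The first factor has n-th power 1 and
   spectrum S_n. The n-th power of Q is close to 1, so it has a logarithm n W
   commuting with Q, and Q exp(-W) is an n-th root of the identity. Such a root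
   is a combination of its spectral idempotents with coefficients in S_n, hence
   an exponential, and so is Q. Finally z in the spectrum of Q forces z^n - 1 to
   be small. *)
Require Import Defs.
From mathcomp Require Import all_boot all_order all_algebra.
From mathcomp Require Import all_classical all_reals all_analysis.
From mathcomp Require Import cyclic separable cyclotomic ring lra.

Set Implicit Arguments.
Unset Strict Implicit.
Unset Printing Implicit Defensive.

Import Order.TTheory GRing.Theory Num.Theory.
Import numFieldNormedType.Exports.

Local Open Scope classical_set_scope.
Local Open Scope ring_scope.

(** * Cauchy products and the real exponential series *)

(** The pairs with [i + j < m] are exactly those of the first [m] terms of the Cauchy product, so
    the corner [i + j >= m] of the square is left. *)
Lemma sum_mul_sub_triangle (S : pzRingType) (a b : nat -> S) m :
  (\sum_(0 <= i < m) a i) * (\sum_(0 <= j < m) b j)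
    - \sum_(0 <= k < m) \sum_(0 <= j < k.+1) a (k - j)%N * b j
  = \sum_(0 <= j < m) \sum_(m - j <= i < m) a i * b j.
Proof.
have tri : \sum_(0 <= k < m) \sum_(0 <= j < k.+1) a (k - j)%N * b j
    = \sum_(0 <= j < m) \sum_(0 <= i < m - j) a i * b j.
  elim: m => [|m IH]; first by rewrite !big_geq.
  rewrite big_nat_recr //= IH.
  rewrite [LHS]addrC big_nat_recr //= [RHS]big_nat_recr //=.
  rewrite subnn subSn // subnn big_nat1 addrAC; congr (_ + _).
  rewrite -big_split /=; apply: eq_big_nat => j /andP[_ jm].
  by rewrite subSn ?(ltnW jm) // big_nat_recr //= addrC.
rewrite tri mulr_sumr -sumrB; apply: eq_big_nat => j /andP[_ jm].
rewrite mulr_suml (@big_cat_nat _ _ _ (m - j)) ?leq_subr //=.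
by rewrite addrAC subrr add0r.
Qed.

Section RealExp.
Variable R : realType.

Definition exp_sum (x : R) m := \sum_(0 <= k < m) k`!%:R^-1 * x ^+ k.

Lemma exp_sumE x : exp_sum x = series (exp_coeff x).
Proof.
by apply/funext => m; apply: eq_bigr => k _; rewrite mulrC.
Qed.

Lemma exp_sum_cvg x : exp_sum x m @[m --> \oo] --> expR x.
Proof. by rewrite exp_sumE; exact: is_cvg_series_exp_coeff. Qed.

Lemma exp_sum_le_expR x m : 0 <= x -> exp_sum x m <= expR x.
Proof.
move=> x0; rewrite exp_sumE; apply: nondecreasing_cvgn_le.
  apply/nondecreasing_seqP => k.
  by rewrite /series /= big_nat_recr //= lerDl exp_coeff_ge0.
exact: is_cvg_series_exp_coeff.
Qed.

Lemma invfactM (F : numFieldType) i j :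
  (i`!%:R^-1 * j`!%:R^-1 : F) = (i + j)`!%:R^-1 *+ 'C(i + j, j).
Proof.
have fn k : (k`!%:R != 0 :> F) by rewrite pnatr_eq0 -lt0n fact_gt0.
rewrite -(bin_fact (leq_addl i j)) addnK -[RHS]mulr_natr !natrM.
have bn : 'C(i + j, j)%:R != 0 :> F.
  by rewrite pnatr_eq0 -lt0n bin_gt0 leq_addl.
by field; rewrite !fn bn.
Qed.

(** From [expR (- d) >= 1 - d] one gets [expR d <= 1 / (1 - d)], and
    [1 / (1 - d) - 1 - d = d ^ 2 / (1 - d)]. *)
Lemma expR_sub_le (d : R) : 0 <= d <= 1/2 -> expR d - 1 - d <= 2 * d ^+ 2.
Proof.
move=> /andP[d0 d1].
have h := expR_ge1Dx (- d); have p := expR_gt0 d.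
have : expR d * expR (- d) = 1 by rewrite -expRD subrr expR0.
move=> e; have : expR d * (1 - d) <= 1 by rewrite -[leRHS]e ler_pM2l.
nra.
Qed.

End RealExp.

(** * Exponentials in a complete normed algebra *)

(** A Banach algebra presented by a real-valued norm and a central image of the complex numbers, the
    form in which matrices with [op_norm] appear. Completeness uses an explicit Cauchy modulus [b];
    [cn1] is an inequality so that matrices of size 0 are included. *)
Record complete_norm (R : realType) (T : pzRingType)
    (iota : {rmorphism R[i] -> T}) (N : T -> R) : Prop := CompleteNorm {
  cn_ge0 : forall x, 0 <= N x;
  cn_eq0 : forall x, N x = 0 -> x = 0;
  cnD : forall x y, N (x + y) <= N x + N y;
  cnM : forall x y, N (x * y) <= N x * N y;
  cn1 : N 1 <= 1;
  cn_iota : forall c, N (iota c) <= complex.Re `|c|;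
  cn_central : forall c x, GRing.comm (iota c) x;
  cn_complete : forall (u : nat -> T) (b : nat -> R),
    b m @[m --> \oo] --> 0 ->
    (forall n m, (n <= m)%N -> N (u m - u n) <= b n) ->
    exists l, N (l - u m) @[m --> \oo] --> 0
}.

Lemma Re_norm_real (R : realType) (x : R) : 0 <= x -> complex.Re `|x%:C%C| = x.
Proof. by move=> x0; rewrite ger0_norm ?ler0c. Qed.

Lemma invfactC (R : realType) k :
  (k`!%:R^-1 : R[i]) = ((k`!%:R^-1 : R)%:C)%C.
Proof. by rewrite fmorphV /= rmorph_nat. Qed.

(** The hypothesis on [c] is the identity satisfied by [1 / k!], which turns a Cauchy product term
    into the binomial theorem. An abstract [c] serves both the real coefficients and those in the
    algebra. *)
Lemma exp_sum_binomial (S : pzRingType) (c : nat -> S) (x y : S) k :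
  (forall i j, c i * c j = c (i + j)%N *+ 'C(i + j, j)) ->
  (forall i z, GRing.comm (c i) z) -> GRing.comm x y ->
  \sum_(0 <= j < k.+1) (c (k - j)%N * x ^+ (k - j)) * (c j * y ^+ j)
    = c k * (x + y) ^+ k.
Proof.
move=> cM cC xy; rewrite exprDn_comm // big_mkord mulr_sumr.
apply: eq_bigr => j _; have jk : (j <= k)%N by rewrite -ltnS.
rewrite mulrA -(mulrA (c _)) -(cC j) !mulrA cM subnK // -!mulrA mulrnAl.
by rewrite mulrnAr.
Qed.

Section BanachExp.
Variables (R : realType) (T : pzRingType) (iota : {rmorphism R[i] -> T}).
Variable N : T -> R.
Hypothesis hN : complete_norm iota N.
Implicit Types (x y E : T) (u v : nat -> T).

Let N_ge0 x : 0 <= N x := cn_ge0 hN x.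

Lemma cn0 : N 0 = 0.
Proof.
apply/eqP; rewrite eq_le N_ge0 // andbT -(rmorph0 iota).
by apply: le_trans (cn_iota hN _) _; rewrite normr0.
Qed.

Lemma cnN x : N (- x) = N x.
Proof.
have le y : N (- y) <= N y.
  rewrite -mulN1r -(rmorph1 iota) -rmorphN; apply: le_trans (cnM hN _ _) _.
  rewrite -[leRHS]mul1r ler_wpM2r ?N_ge0 //.
  by apply: le_trans (cn_iota hN _) _; rewrite normrN normr1.
by apply/eqP; rewrite eq_le le -{1}(opprK x) le.
Qed.

Lemma comm_iota c x : GRing.comm x (iota c).
Proof. exact/commr_sym/(cn_central hN). Qed.

Lemma cnB x y : N (x - y) = N (y - x).
Proof. by rewrite -cnN opprB. Qed.

Lemma cn_sum (I : Type) (r : seq I) (P : pred I) (F : I -> T) (G : I -> R) :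
  (forall i, P i -> N (F i) <= G i) ->
  N (\sum_(i <- r | P i) F i) <= \sum_(i <- r | P i) G i.
Proof.
move=> FG; elim/big_rec2: _ => [|i a b Pi ab]; first by rewrite cn0.
by apply: le_trans (cnD hN _ _) _; rewrite lerD ?FG.
Qed.

Lemma cnX x k : N (x ^+ k) <= N x ^+ k.
Proof.
elim: k => [|k IH]; first by rewrite !expr0 (cn1 hN).
rewrite !exprS; apply: le_trans (cnM hN _ _) _.
by rewrite ler_wpM2l ?N_ge0.
Qed.

(** [T] carries no topology, so convergence is expressed through [N] alone. *)
Definition tends u x := N (x - u m) @[m --> \oo] --> 0.

Lemma tends_squeeze u x (b : nat -> R) :
  b m @[m --> \oo] --> 0 -> (forall m, N (x - u m) <= b m) -> tends u x.
Proof.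
move=> b0 le; apply: (squeeze_cvgr _ (cvg_cst 0) b0).
by apply: nearW => m /=; rewrite N_ge0 //= le.
Qed.

Lemma tends_le u x y (b : R) n : tends u x ->
  (forall m, (n <= m)%N -> N (u m - y) <= b) -> N (x - y) <= b.
Proof.
move=> ux le.
have h : (N (x - u m) + b) @[m --> \oo] --> 0 + b.
  by apply: cvgD => //; exact: cvg_cst.
rewrite -[b]add0r -(cvg_lim _ h) //; apply: limr_ge.
  by apply/cvg_ex; exists (0 + b).
exists n => // m /= nm; rewrite -(subrKA (u m)).
by apply: le_trans (cnD hN _ _) _; rewrite lerD2l le.
Qed.

Lemma tends_uniq u x y : tends u x -> tends u y -> x = y.
Proof.
move=> ux uy; apply/eqP; rewrite -subr_eq0; apply/eqP/(cn_eq0 hN)/eqP.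
rewrite eq_le N_ge0 // andbT.
have h : (N (x - u m) + N (y - u m)) @[m --> \oo] --> 0 + 0 by exact: cvgD.
rewrite -[leRHS]addr0 -(cvg_lim _ h) //; apply: limr_ge.
  by apply/cvg_ex; exists (0 + 0).
apply: nearW => m; rewrite -(subrKA (u m)) (cnB y).
exact: (cnD hN).
Qed.

Lemma tends_cst x : tends (fun=> x) x.
Proof. by rewrite /tends subrr cn0; exact: cvg_cst. Qed.

Lemma tendsD u v x y : tends u x -> tends v y ->
  tends (fun m => u m + v m) (x + y).
Proof.
move=> ux vy.
have h : (N (x - u m) + N (y - v m)) @[m --> \oo] --> 0 + 0 by exact: cvgD.
rewrite addr0 in h; apply: (tends_squeeze h) => m.
by rewrite opprD addrACA; exact: (cnD hN).
Qed.

Lemma tends_sum (I : Type) (r : seq I) (u : I -> nat -> T) (x : I -> T) :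
  (forall i, tends (u i) (x i)) ->
  tends (fun m => \sum_(i <- r) u i m) (\sum_(i <- r) x i).
Proof.
move=> ux; elim: r => [|i r IH].
  rewrite big_nil (_ : (fun _ => _) = fun=> 0); first exact: tends_cst.
  by apply/funext => m; rewrite big_nil.
rewrite big_cons (_ : (fun _ => _) = fun m => u i m + \sum_(j <- r) u j m).
  exact: tendsD.
by apply/funext => m; rewrite big_cons.
Qed.

Lemma tendsM u v x y : tends u x -> tends v y ->
  tends (fun m => u m * v m) (x * y).
Proof.
move=> ux vy.
have h : (N (x - u m) * N y + (N x + N (x - u m)) * N (y - v m))
    @[m --> \oo] --> 0 * N y + (N x + 0) * 0.
  by apply: cvgD; apply: cvgM => //; [exact: cvg_cst|apply: cvgD => //;
    exact: cvg_cst].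
rewrite mul0r mulr0 addr0 in h; apply: tends_squeeze h _ => m.
have -> : x * y - u m * v m = (x - u m) * y + u m * (y - v m).
  by rewrite mulrBl mulrBr addrA subrK.
apply: le_trans (cnD hN _ _) _; apply: lerD; first exact: (cnM hN).
apply: le_trans (cnM hN _ _) _; rewrite ler_wpM2r ?N_ge0 //.
have {1}-> : u m = x + - (x - u m) by rewrite opprB addrC subrK.
by apply: le_trans (cnD hN _ _) _; rewrite cnN.
Qed.

Lemma tends_comm u x y : tends u x -> (forall m, GRing.comm (u m) y) ->
  GRing.comm x y.
Proof.
move=> ux uy; apply: (@tends_uniq (fun m => u m * y)).
  by apply: tendsM => //; exact: tends_cst.
rewrite (_ : (fun m => _) = fun m => y * u m); last exact/funext/uy.
by apply: tendsM => //; exact: tends_cst.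
Qed.

Definition alg_exp_sum x m := \sum_(0 <= k < m) iota k`!%:R^-1 * x ^+ k.

Definition has_exp x := tends (alg_exp_sum x).

Lemma cn_exp_term x k :
  N (iota k`!%:R^-1 * x ^+ k) <= k`!%:R^-1 * N x ^+ k.
Proof.
apply: le_trans (cnM hN _ _) _; apply: ler_pM; rewrite ?N_ge0 ?cnX //.
apply: le_trans (cn_iota hN _) _.
by rewrite invfactC Re_norm_real // invr_ge0.
Qed.

(** Each term is dominated by that of the real series at [N x]. The bound tends to 0 and becomes the
    modulus [b] of [cn_complete]. *)
Lemma alg_exp_sum_tail x n m : (n <= m)%N ->
  N (alg_exp_sum x m - alg_exp_sum x n) <= expR (N x) - exp_sum (N x) n.
Proof.
move=> nm; rewrite /alg_exp_sum (@big_cat_nat _ _ _ n) //= addrAC subrr add0r.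
apply: le_trans (cn_sum _ (fun k _ => cn_exp_term x k)) _.
rewrite lerBrDl; apply: le_trans _ (exp_sum_le_expR m (N_ge0 x)).
by rewrite /exp_sum [leRHS](@big_cat_nat _ _ _ n).
Qed.

Lemma has_exp_ex x : exists E, has_exp x E.
Proof.
apply: (cn_complete hN _ (@alg_exp_sum_tail x)).
rewrite -(subrr (expR (N x))); apply: cvgB; [exact: cvg_cst|exact: exp_sum_cvg].
Qed.

Lemma has_exp_uniq x E E' : has_exp x E -> has_exp x E' -> E = E'.
Proof. exact: tends_uniq. Qed.

(** The tail after two terms is dominated by the real one, which [expR_sub_le] controls. This
    quadratic error is what makes Newton's iteration for the logarithm converge. *)
Lemma has_exp_quad x E : has_exp x E -> N x <= 1/2 ->
  N (E - 1 - x) <= 2 * N x ^+ 2.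
Proof.
move=> xE x2; rewrite -addrA -opprD.
apply: (@tends_le _ _ _ _ 2 xE) => m m2.
have -> : 1 + x = alg_exp_sum x 2.
  rewrite /alg_exp_sum big_nat_recr //= big_nat1 !fact0 invr1 rmorph1.
  by rewrite !mul1r expr0 expr1.
apply: le_trans (alg_exp_sum_tail _ m2) _.
rewrite /exp_sum big_nat_recr //= big_nat1 !fact0 invr1 !mul1r expr0 expr1
  opprD addrA.
by apply: expR_sub_le; rewrite N_ge0.
Qed.

Lemma has_exp0 : has_exp 0 1.
Proof.
apply: cvg_near_cst; exists 1%N => // m /= m1; apply/eqP.
rewrite /alg_exp_sum big_ltn // expr0 fact0 invr1 rmorph1 mulr1.
rewrite big_nat big1 ?addr0 ?subrr ?cn0 // => k /andP[k1 _].
by rewrite expr0n (gtn_eqF k1) mulr0.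
Qed.

(** The product of the partial sums differs from the partial sum at [x + y] by a corner of terms
    with [i + j >= m]. The same corner for the reals [N x] and [N y] dominates it, and that one
    vanishes in the limit by [expRD]. *)
Lemma has_expD x y E F : GRing.comm x y -> has_exp x E -> has_exp y F ->
  has_exp (x + y) (E * F).
Proof.
move=> xy xE yF.
pose b m := exp_sum (N x) m * exp_sum (N y) m - exp_sum (N x + N y) m.
have b0 : b m @[m --> \oo] --> 0.
  rewrite -(subrr (expR (N x + N y))); apply: cvgB; last exact: exp_sum_cvg.
  by rewrite expRD; apply: cvgM; exact: exp_sum_cvg.
have le m : N (alg_exp_sum x m * alg_exp_sum y m - alg_exp_sum (x + y) m) <= b
  m.
  have cR (i j : nat) : i`!%:R^-1 * j`!%:R^-1 = (i + j)`!%:R^-1 *+ 'C(i + j,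
    j) :> R.
    exact: invfactM.
  have cT (i j : nat) : iota i`!%:R^-1 * iota j`!%:R^-1
      = iota (i + j)`!%:R^-1 *+ 'C(i + j, j).
    by rewrite -rmorphM invfactM rmorphMn.
  rewrite /b /exp_sum /alg_exp_sum.
  under [X in _ - X]eq_bigr do
    rewrite -(exp_sum_binomial _ cT (fun _ => cn_central hN _) xy).
  under [X in _ <= _ - X]eq_bigr do
    rewrite -(exp_sum_binomial _ cR (fun _ _ => mulrC _ _) (mulrC _ _)).
  rewrite (sum_mul_sub_triangle (fun i => iota i`!%:R^-1 * x ^+ i)).
  rewrite (sum_mul_sub_triangle (fun i => i`!%:R^-1 * N x ^+ i)).
  apply: cn_sum => j _; apply: cn_sum => i _; apply: le_trans (cnM hN _ _) _.
  by rewrite ler_pM ?N_ge0 // cn_exp_term.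
have h : (N (E * F - alg_exp_sum x m * alg_exp_sum y m) + b m)
    @[m --> \oo] --> 0 + 0 by apply: cvgD => //; exact: tendsM.
rewrite addr0 in h; apply: (tends_squeeze h) => m.
rewrite -(subrKA (alg_exp_sum x m * alg_exp_sum y m)).
by apply: le_trans (cnD hN _ _) _; rewrite lerD.
Qed.

Lemma has_exp_mulrn x E n : has_exp x E -> has_exp (x *+ n) (E ^+ n).
Proof.
move=> xE; elim: n => [|n IH]; first exact: has_exp0.
by rewrite mulrS exprS; apply: has_expD => //; exact: commrMn.
Qed.

Lemma has_exp_comm x y E : has_exp x E -> GRing.comm x y -> GRing.comm E y.
Proof.
move=> xE xy; apply: tends_comm xE _ => m; apply: commr_sym;
  apply: commr_sum => k _.
apply: commrM; first exact/commr_sym/(cn_central hN).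
by apply: commrX; exact: commr_sym.
Qed.

Lemma has_expN x E F : has_exp x E -> has_exp (- x) F -> E * F = 1.
Proof.
move=> xE xF; apply: has_exp_uniq has_exp0; rewrite -(subrr x).
by apply: has_expD => //; exact: commrN.
Qed.

Lemma has_exp_conj p q x E : p * q = 1 -> q * p = 1 -> has_exp x E ->
  has_exp (p * x * q) (p * E * q).
Proof.
move=> pq qp xE.
have -> : has_exp (p * x * q) = tends (fun m => p * alg_exp_sum x m * q).
  congr tends; apply/funext => m; rewrite mulr_sumr mulr_suml.
  apply: eq_bigr => k _; rewrite mulrA -(cn_central hN) -!mulrA; congr (_ * _).
  elim: k => [|k IH]; first by rewrite !expr0 mul1r.
  by rewrite !exprS IH !mulrA -(mulrA (p * x)) qp mulr1.
by apply: tendsM; [apply: tendsM => //|]; exact: tends_cst.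
Qed.

End BanachExp.

(** * Complex roots of unity *)

Section Roots.
Variable R : realType.

(** The polynomial [X^n - 1] splits and is separable, so it has [n] distinct roots, and [n] distinct
    [n]-th roots of unity in a field include a primitive one. *)
Lemma complex_prim_root n : (0 < n)%N -> exists w : R[i], n.-primitive_root w.
Proof.
move=> n0; pose p : {poly R[i]} := 'X^n - 1.
have [r] := closed_field_poly_normal p.
rewrite (monicP _) ?monicXnsubC // scale1r => Dp.
have rn1 : all n.-unity_root r by apply/allP => z; rewrite -root_prod_XsubC -Dp.
have sz_r : (n < (size r).+1)%N.
  by rewrite -(size_prod_XsubC r id) -Dp size_XnsubC.
have [|z] := hasP (has_prim_root n0 rn1 _ sz_r); last by exists z.
by rewrite -separable_prod_XsubC -Dp separable_Xn_sub_1 // pnatr_eq0 -lt0n.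
Qed.

Lemma unity_root_neq0 n (z : R[i]) : (0 < n)%N -> z ^+ n = 1 -> z != 0.
Proof.
by move=> n0; apply: contra_eq_neq => ->;
  rewrite expr0n gtn_eqF // eq_sym oner_eq0.
Qed.

Lemma norm_unity_root n (z : R[i]) : (0 < n)%N -> z ^+ n = 1 -> `|z| = 1.
Proof.
move=> n0 zn; apply/eqP; rewrite -(@pexpr_eq1 _ _ n) //.
by rewrite -normrX zn normr1.
Qed.

(** If every factor of [z ^ n - 1 = prod_i (z - w ^ i)] had modulus above [e], the product would
    have modulus above [e ^ n]. *)
Lemma near_unity_root n (z : R[i]) (e : R) : (0 < n)%N -> 0 <= e ->
  complex.Re `|z ^+ n - 1| <= e ^+ n ->
  exists2 y, y ^+ n = 1 & `|z - y| <= e%:C%C.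
Proof.
move=> n0 e0 zn; apply: contrapT => far.
have [w wP] := complex_prim_root n0.
have ReC (x : R[i]) : `|x| = (complex.Re `|x|)%:C%C by case: x.
have lt y : y ^+ n = 1 -> e%:C%C < `|z - y|.
  move=> yn; rewrite real_ltNge ?normr_real ?ger0_real ?ler0c //.
  by apply/negP => le; apply: far; exists y.
have : (e ^+ n)%:C%C < `|z ^+ n - 1|.
  have -> : z ^+ n - 1 = \prod_(0 <= i < n) (z - w ^+ i).
    have := congr1 (horner^~ z) (factor_Xn_sub_1 wP).
    rewrite horner_prod hornerD hornerN hornerXn hornerC => <-.
    by apply: eq_bigr => i _; rewrite hornerXsubC.
  rewrite normr_prod rmorphXn /= -[n in _ ^+ n]subn0 -prodr_const_nat.
  apply: ltr_prod_nat => // i _.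
  by rewrite ler0c e0 /= lt // exprAC (prim_expr_order wP) expr1n //.
by rewrite ReC ltcR ltNge zn.
Qed.

(** Orthogonality of the characters of the cyclic group: for [j != k] this is a geometric sum whose
    ratio is an [n]-th root of unity other than 1. *)
Lemma sum_prim_root n (w : R[i]) (j k : nat) : n.-primitive_root w ->
  (j < n)%N -> (k < n)%N ->
  n%:R^-1 * \sum_(i < n) (w ^- j * w ^+ k) ^+ i = (j == k)%:R.
Proof.
move=> wP jn kn; have n0 := prim_root_natf_neq0 wP.
have w0 : w != 0 by exact: unity_root_neq0 (prim_order_gt0 wP)
  (prim_expr_order wP).
have [->|jk] := eqVneq j k.
  rewrite mulVf ?expf_neq0 //; under eq_bigr do rewrite expr1n.
  by rewrite sumr_const card_ord mulVf.
have c1 : w ^- j * w ^+ k != 1.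
  apply: contraNneq jk => e; rewrite -(modn_small jn) -(modn_small kn).
  rewrite -(eq_prim_root_expr wP) -[w ^+ j]mulr1 -e mulrA divff ?mul1r //.
  exact: expf_neq0.
have cn : (w ^- j * w ^+ k) ^+ n = 1.
  by rewrite exprMn exprVn -!exprM ![(_ * n)%N]mulnC !exprM (prim_expr_order
    wP) !expr1n invr1 mulr1.
suff -> : \sum_(i < n) (w ^- j * w ^+ k) ^+ i = 0 by rewrite mulr0.
apply/eqP; have := subrX1 (w ^- j * w ^+ k) n.
move/esym/eqP; rewrite cn subrr mulf_eq0 subr_eq0.
by rewrite (negPf c1).
Qed.

End Roots.

Lemma geometric_sum_shift (S : pzRingType) (x : S) n : x ^+ n = 1 ->
  x * \sum_(j < n) x ^+ j = \sum_(j < n) x ^+ j.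
Proof.
move=> xn; apply/eqP; rewrite -subr_eq0 -[X in _ - X]mul1r -mulrBl.
by rewrite -subrX1 xn subrr.
Qed.

(** * Logarithms and resolvents in a complete normed algebra *)

Section BanachLog.
Variables (R : realType) (T : pzRingType) (iota : {rmorphism R[i] -> T}).
Variable N : T -> R.
Hypothesis hN : complete_norm iota N.
Implicit Types (x y E : T).

Local Notation has_exp := (has_exp iota N).

Let N_ge0 x : 0 <= N x := cn_ge0 hN x.

(* Newton's iteration for the equation [exp W = 1 + X]: if
   [1 + X = exp W (1 + D)] then the next approximation of the logarithm is
   [W + D], with defect [exp (- D) (1 + D) - 1 = O(D ^ 2)]. *)
Lemma log_near1 X : N X <= 1/8 ->
  exists2 W, has_exp W (1 + X) & forall y, GRing.comm X y -> GRing.comm W y.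
Proof.
move=> X8; have [e eP] := choice (has_exp_ex hN).
pose step (p : T * T) := (p.1 + p.2, e (- p.2) * (1 + p.2) - 1).
pose s k := iter k step (0, X).
pose W k := (s k).1; pose D k := (s k).2.
have WS k : W k.+1 = W k + D k by [].
have DS k : D k.+1 = e (- D k) * (1 + D k) - 1 by [].
have comm k y : GRing.comm X y -> GRing.comm (W k) y /\ GRing.comm (D k) y.
  move=> Xy; elim: k => [|k [Wy Dy]]; first by split => //;
    exact/commr_sym/commr0.
  rewrite WS DS; split; apply: commr_sym.
    by apply: commrD; exact: commr_sym.
  have yD1 : GRing.comm y (1 + D k).
    by apply: commrD; [exact: commr1|exact: commr_sym].
  apply: commrB; last exact: commr1.
  apply: commrM => //; apply: commr_sym; apply: (has_exp_comm hN (eP _)).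
  exact/commr_sym/commrN/commr_sym.
have DD j k : GRing.comm (W j) (D k) by have [] := comm j (D k) (commr_sym
  (comm k X erefl).2).
(* The defects decrease quadratically, but the geometric rate [t k / 8] suffices. *)
pose t k : R := 2^-1 ^+ k.
have t0 k : 0 < t k by rewrite exprn_gt0 // invr_gt0.
have t1 k : t k <= 1 by rewrite exprn_ile1 ?invr_ge0 //; lra.
have tS k : t k.+1 = t k / 2 by rewrite /t exprS mulrC.
(* With [d = N (D k)], the new defect [r + (r D - D D)] has norm at most [3 d^2 + 2 d^3], which is
   below [d / 2] because [d <= 1/8]. *)
have Dle k : N (D k) <= t k / 8.
  elim: k => [|k IH]; first by rewrite /t expr0.
  set d := N (D k) in IH; have d0 : 0 <= d by exact: N_ge0.
  have d8 : d <= 1/8 by have := t1 k; lra.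
  have Q := has_exp_quad hN (eP (- D k)); rewrite (cnN hN) -/d in Q.
  have {Q}Q : N (e (- D k) - 1 - - D k) <= 2 * d ^+ 2 by apply: Q; lra.
  rewrite DS; set r := _ - _ - _ in Q.
  have -> : e (- D k) * (1 + D k) - 1 = r + (r * D k - D k * D k).
    have -> : e (- D k) = r + (1 - D k) by rewrite /r opprK (addrC 1) addrA
      addrK subrK.
    have sq : (1 - D k) * (1 + D k) = 1 - D k * D k.
      by rewrite mulrBl mul1r mulrDr mulr1 opprD addrA addrK.
    rewrite mulrDl sq mulrDr mulr1 -[LHS]addrA (addrAC 1) subrr add0r.
    by rewrite addrA.
  have h1 := cnD hN r (r * D k - D k * D k).
  have h2 := cnD hN (r * D k) (- (D k * D k)); rewrite (cnN hN) in h2.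
  have h3 := cnM hN r (D k); have h4 := cnM hN (D k) (D k).
  rewrite -/d in h3 h4; rewrite tS.
  have h5 : N r * d <= 2 * d ^+ 2 * d by rewrite ler_wpM2r.
  nra.
have inv k : e (W k) * (1 + D k) = 1 + X.
  elim: k => [|k IH].
    by rewrite (has_exp_uniq hN (eP _) (has_exp0 hN)) mul1r.
  rewrite WS (has_exp_uniq hN (eP _) (has_expD hN (DD k k) (eP _) (eP _))).
  rewrite DS addrC subrK mulrA -(mulrA (e (W k))).
  by rewrite (has_expN hN (eP _) (eP _)) mulr1 IH.
(* The increments are at most [t i / 8], and these sum to [t n / 4] over all [i >= n]. *)
have Wle n m : (n <= m)%N -> N (W m - W n) <= t n / 4.
  move=> /subnK <-; move: (m - n)%N => {m} j; elim: j n => [|j IH] n.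
    by rewrite add0n subrr (cn0 hN); have := t0 n; lra.
  rewrite addSnnS -(subrKA (W n.+1)).
  apply: le_trans (cnD hN _ _) _.
  have := IH n.+1; have := Dle n; rewrite WS (addrC (W n)) addrK tS; lra.
have tcvg : t m @[m --> \oo] --> 0.
  by apply: cvg_expr; rewrite ger0_norm ?invr_ge0 //; lra.
have bcvg : (t m / 4) @[m --> \oo] --> 0.
  by rewrite -(mul0r (4^-1)); apply: cvgM => //; exact: cvg_cst.
have [Wl lim] := cn_complete hN bcvg Wle.
exists Wl; last first.
  by move=> y Xy; apply: (tends_comm hN lim) => k; have [] := comm k y Xy.
(* By [inv] and commutation, [e (- Wl) * (1 + X)] equals [e (W k - Wl) * (1 + D k)] for every [k].
   The latter is within [t k] of 1, so the constant is 1. *)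
suff E1 : e (- Wl) * (1 + X) = 1.
  have := has_expN hN (eP Wl) (eP (- Wl)) => E2.
  have -> : 1 + X = e Wl; last exact: eP.
  by rewrite -[LHS]mul1r -[X in X * _ = _]E2 -mulrA E1 mulr1.
have cWl k : GRing.comm Wl (W k).
  by apply: (tends_comm hN lim) => j;
    have [] := comm j (W k) (commr_sym (comm k X erefl).1).
apply: (tends_uniq hN (u := fun=> e (- Wl) * (1 + X)));
  first exact: (tends_cst hN).
apply: (tends_squeeze hN tcvg) => k; rewrite (cnB hN).
pose V := W k - Wl.
have Vle : N V <= t k / 4.
  by rewrite (cnB hN); apply: (tends_le hN (n := k) lim); exact: Wle.
have -> : e (- Wl) * (1 + X) = e V * (1 + D k).
  rewrite -(inv k) mulrA; congr (_ * _).
  have -> : V = - Wl + W k by rewrite addrC.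
  apply: (has_exp_uniq hN _ (eP _)); apply/(has_expD hN _ (eP _) (eP _)).
  exact/commr_sym/commrN/commr_sym.
have Q := has_exp_quad hN (eP V).
set Z := e V - 1 in Q.
have -> : e V * (1 + D k) - 1 = Z + (D k + Z * D k).
  have -> : e V = Z + 1 by rewrite subrK.
  rewrite mulrDl mul1r -addrA (addrC 1) addrK mulrDr mulr1 addrAC.
  by rewrite addrC (addrC (D k)).
have h1 := cnD hN Z (D k + Z * D k); have h2 := cnD hN (D k) (Z * D k).
have h3 := cnM hN Z (D k); have h4 := Dle k; have := t1 k;
  have := t0 k => t0k t1k.
have {}Q : N (Z - V) <= 2 * N V ^+ 2 by apply: Q; lra.
have h5 : N Z <= 2 * N V.
  have := cnD hN (Z - V) V; rewrite subrK; have := N_ge0 V; nra.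
have : N Z * N (D k) <= 2 * (t k / 4) * (t k / 8).
  by apply: ler_pM => //; lra.
nra.
Qed.

(** Repeated square roots bring [z] close to 1, where [log_near1] applies; doubling the logarithm
    undoes each root. Centrality comes from that of the scalars. *)
Lemma exp_unit_scalar (z : R[i]) : `|z| = 1 ->
  exists2 W, has_exp W (iota z) & forall y, GRing.comm W y.
Proof.
(* On the unit circle [2 - 2 * a] is the squared distance to 1. The square root with nonnegative
   real part at least halves it, and at [m = 0] the distance is at most [1/8]. *)
have key m (a b : R) : a ^+ 2 + b ^+ 2 = 1 -> 2 - 2 * a <= 64^-1 * 2 ^+ m ->
    exists2 W, has_exp W (iota (a +i* b)%C) & forall y, GRing.comm W y.
  elim: m a b => [|m IH] a b ab am.
    have X8 : N (iota ((a +i* b)%C - 1)) <= 1/8.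
      apply: le_trans (cn_iota hN _) _ => /=.
      rewrite -[leRHS]ger0_norm ?divr_ge0 // -sqrtr_sqr ler_wsqrtr //.
      by rewrite expr0 in am; nra.
    have [W We Wc] := log_near1 X8.
    exists W; last by move=> y; apply: Wc; exact: (cn_central hN).
    by move: We; rewrite rmorphB rmorph1 addrC subrK.
  have [c [d [c0 cd1 cd2]]] : exists c d, [/\ 0 <= c, c ^+ 2 - d ^+ 2 = a & 2
    * c * d = b].
    have := sqrtCK (a +i* b)%C; case: (sqrtC _) => c d.
    rewrite expr2 => -[h1 h2].
    have [c0|c0] := leP 0 c; [exists c, d|exists (- c), (- d)]; split; nra.
  have cd : c ^+ 2 + d ^+ 2 = 1.
    have : (c ^+ 2 + d ^+ 2) ^+ 2 = 1 by rewrite -ab -cd1 -cd2; ring.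
    by move/eqP; rewrite sqrf_eq1 => /orP[/eqP//|/eqP]; nra.
  have [|W We Wc] := IH c d cd.
    move: am; rewrite exprS; nra.
  exists (W *+ 2); last by move=> y; apply: commr_sym; apply: commrMn;
    exact: commr_sym.
  have := has_exp_mulrn hN 2 We; rewrite -rmorphXn; congr (has_exp _ (iota _)).
  by rewrite expr2 -cd1 -cd2; congr Complex; ring.
case: z => a b [h].
have ab : a ^+ 2 + b ^+ 2 = 1.
  by rewrite -[LHS]sqr_sqrtr ?addr_ge0 ?sqr_ge0 // h expr1n.
(* The squared distance never exceeds 4, which is [2 ^ 8 / 64]. *)
apply: (key 8%N) => //.
have : -1 <= a by nra.
lra.
Qed.

(* The spectral idempotents of [Q] are [E k = n^-1 \sum_j w^(-jk) Q^j]. *)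
Lemma log_root_of_1 n Q : (0 < n)%N -> Q ^+ n = 1 ->
  exists2 L, has_exp L Q & forall y, GRing.comm Q y -> GRing.comm L y.
Proof.
move=> n0 Qn; have [w wP] := complex_prim_root R n0.
have w0 : w != 0 by exact: unity_root_neq0 (prim_order_gt0 wP)
  (prim_expr_order wP).
have nwk k : `|w ^+ k| = 1.
  apply: (norm_unity_root n0).
  by rewrite exprAC (prim_expr_order wP) expr1n.
have /choice[l lP] (k : nat) : exists lk,
    has_exp lk (iota (w ^+ k)) /\ forall y, GRing.comm lk y.
  by have [W ? ?] := exp_unit_scalar (nwk k); exists W.
pose x k := iota (w ^- k) * Q.
have xX k i : x k ^+ i = iota ((w ^- k) ^+ i) * Q ^+ i.
  by rewrite exprMn_comm ?rmorphXn //; exact: (cn_central hN).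
have xn k : x k ^+ n = 1.
  by rewrite xX Qn -exprVn exprAC exprVn (prim_expr_order wP) invr1 expr1n
    rmorph1 mulr1.
pose E k := iota n%:R^-1 * \sum_(i < n) x k ^+ i.
have xE k : x k * E k = E k.
  rewrite /E mulrA (comm_iota hN) -mulrA geometric_sum_shift //.
(* A geometric sum in [x k] is fixed by [x k], because [x k ^+ n = 1]; hence [Q] acts on [E k] as
   the scalar [w ^+ k]. *)
have QE k : Q * E k = iota (w ^+ k) * E k.
  rewrite -{2}xE /x !mulrA -rmorphM mulfV ?expf_neq0 // rmorph1 mul1r //.
have xE1 k j : x j * E k = iota (w ^- j * w ^+ k) * E k.
  by rewrite /x -mulrA QE mulrA -rmorphM.
have xEX k j i : x j ^+ i * E k = iota ((w ^- j * w ^+ k) ^+ i) * E k.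
  elim: i => [|i IH]; first by rewrite !expr0 rmorph1.
  by rewrite exprSr -mulrA xE1 mulrA (comm_iota hN) -mulrA IH mulrA -rmorphM
    -exprS.
(* Powers of [x j] act on [E k] as scalars, so [E j] acts on it as the scalar computed by
   [sum_prim_root]. *)
have EE j k : (j < n)%N -> (k < n)%N -> E j * E k = (j == k)%:R * E k.
  move=> jn kn; rewrite {1}/E -mulrA mulr_suml.
  under eq_bigr do rewrite xEX.
  rewrite -mulr_suml -rmorph_sum mulrA -rmorphM sum_prim_root //.
  by rewrite rmorph_nat.
(* After exchanging the sums, orthogonality against the exponent 0 keeps only the term [Q ^+ 0]. *)
have sumE : \sum_(k < n) E k = 1.
  rewrite -mulr_sumr exchange_big /=.
  have -> : \sum_(j < n) \sum_(i < n) x i ^+ j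
      = \sum_(j < n) iota (\sum_(k < n) (w ^- j * w ^+ 0) ^+ k) * Q ^+ j.
    apply: eq_bigr => j _; rewrite rmorph_sum mulr_suml; apply: eq_bigr => k _.
    by rewrite xX expr0 mulr1 -!exprVn exprAC.
  rewrite mulr_sumr (eq_bigr (fun j : 'I_n => (j == 0%N :> nat)%:R * Q ^+ j)).
    rewrite (bigD1 (Ordinal n0)) //= mul1r expr0 big1 ?addr0 // => j j0.
    by rewrite (_ : _ == _ = false) ?mul0r //; apply: negbTE.
  by move=> j _; rewrite mulrA -rmorphM sum_prim_root // rmorph_nat.
have commE k y : GRing.comm Q y -> GRing.comm (E k) y.
  move=> Qy; apply: commr_sym; apply: commrM; first exact: (comm_iota hN).
  apply: commr_sum => i _; apply: commrX; apply: commrM;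
    first exact: (comm_iota hN).
  exact: commr_sym.
exists (\sum_(k < n) E k * l k); last first.
  move=> y Qy; apply: commr_sym; apply: commr_sum => k _; apply: commrM.
    exact/commr_sym/commE.
  exact/commr_sym/(lP k).2.
(* The [l k] are central and the [E k] orthogonal idempotents with sum 1, so powers, and then the
   exponential series, are computed on each [E k] separately. *)
have LX i : (\sum_(k < n) E k * l k) ^+ i = \sum_(k < n) E k * l k ^+ i.
  elim: i => [|i IH].
    by rewrite expr0 -sumE; apply: eq_bigr => k _; rewrite expr0 mulr1.
  rewrite exprS IH mulr_suml; apply: eq_bigr => j _; rewrite mulr_sumr.
  rewrite (bigD1 j) //= big1 ?addr0 => [|k kj].
    rewrite mulrA -(mulrA (E j)) ((lP j).2 (E j)) mulrA EE // eqxx mul1r.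
    by rewrite exprS mulrA.
  rewrite mulrA -(mulrA (E j)) ((lP j).2 (E k)) mulrA EE //.
  by rewrite eq_sym (_ : _ == _ = false) ?mul0r //; exact: negbTE.
have -> : Q = \sum_(k < n) E k * iota (w ^+ k).
  rewrite -[LHS]mulr1 -sumE mulr_sumr; apply: eq_bigr => k _.
  by rewrite QE (comm_iota hN).
rewrite /has_exp (_ : alg_exp_sum _ _ = fun m => \sum_(k < n) E k *
  alg_exp_sum iota (l k) m).
  apply: (tends_sum hN) => k; apply: (tendsM hN); first exact: (tends_cst hN).
  exact: (lP k).1.
apply/funext => m; rewrite /alg_exp_sum.
under eq_bigr do rewrite LX mulr_sumr.
rewrite exchange_big /=; apply: eq_bigr => k _; rewrite mulr_sumr.
by apply: eq_bigr => i _; rewrite mulrA -(comm_iota hN) -mulrA.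
Qed.

Lemma log_near_root_of_1 n Q : (0 < n)%N -> N (Q ^+ n - 1) <= 1/8 ->
  exists L, has_exp L Q.
Proof.
move=> n0 /log_near1[W0]; rewrite addrC subrK => W0e W0c.
pose W := iota n%:R^-1 * W0.
have Wn : W *+ n = W0.
  rewrite -mulrnAl -rmorphMn -[_ *+ n]mulr_natr mulVf ?rmorph1 ?mul1r //.
  by rewrite pnatr_eq0 -lt0n.
(* Commuting with [Q] implies commuting with [Q ^+ n - 1], hence with its logarithm. Applied to [Q]
   itself, this lets [Q * F] be raised to the power [n] factor by factor. *)
have Wc y : GRing.comm Q y -> GRing.comm W y.
  move=> Qy; apply: commr_sym; apply: commrM; first exact: (comm_iota hN).
  apply/commr_sym/W0c/commr_sym/commrB; last exact: commr1.
  exact/commrX/commr_sym.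
have [E We] := has_exp_ex hN W; have [F Fe] := has_exp_ex hN (- W).
have EF := has_expN hN We Fe.
have FE : F * E = 1 by have := has_expN hN Fe; rewrite opprK; apply.
have En : E ^+ n = Q ^+ n.
  by apply: (has_exp_uniq hN _ W0e); rewrite -Wn; exact: has_exp_mulrn.
have WQ : GRing.comm W Q by exact: Wc.
have FQ : GRing.comm F Q.
  by apply: (has_exp_comm hN Fe); apply: commr_sym; apply: commrN;
    exact: commr_sym.
have FW : GRing.comm F W.
  by apply: (has_exp_comm hN Fe); apply: commr_sym; exact: commrN.
have root : (Q * F) ^+ n = 1.
  rewrite exprMn_comm; last exact: commr_sym.
  rewrite -En -exprMn_comm ?EF ?expr1n // /GRing.comm EF FE //.
have [L Le Lc] := log_root_of_1 n0 root.
exists (L + W); rewrite -[Q]mulr1 -FE mulrA; apply: (has_expD hN) => //.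
by apply: Lc; apply: commr_sym; apply: commrM; exact: commr_sym.
Qed.

(** If [1 + X = exp W] then [exp (- W)] is its inverse; this takes the place of the Neumann
    series. *)
Lemma near1_inv X : N X <= 1/8 -> exists Y, (1 + X) * Y = 1 /\ Y * (1 + X) = 1.
Proof.
move=> /log_near1[W We _]; have [F Fe] := has_exp_ex hN (- W).
exists F; split; first exact: has_expN Fe.
by have := has_expN hN Fe; rewrite opprK; apply.
Qed.

(** [z - Q] divides [z^n - Q^n] with a cofactor [G] that commutes with it. With [c = z^n - 1] and
    [X = Q^n - 1], that difference is [c (1 - c^-1 X)], invertible since [c^-1 X] has norm at most
    [1/8]. *)
Lemma resolvent_near_roots n Q (z : R[i]) : (0 < n)%N ->
  8 * N (Q ^+ n - 1) < complex.Re `|z ^+ n - 1| ->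
  exists Y, (iota z - Q) * Y = 1 /\ Y * (iota z - Q) = 1.
Proof.
set X := Q ^+ n - 1; set c := z ^+ n - 1 => n0 Xc.
have c0 : c != 0.
  by apply/eqP => c0; move: Xc; rewrite c0 normr0 /=; have := N_ge0 X; lra.
have rc0 : 0 < complex.Re `|c|.
  by have := N_ge0 X; move: Xc => /[swap] h; apply: le_lt_trans; lra.
have X8 : N (- (iota c^-1 * X)) <= 1/8.
  rewrite (cnN hN); apply: le_trans (cnM hN _ _) _.
  apply: (@le_trans _ _ ((complex.Re `|c|)^-1 * N X)).
    apply: ler_wpM2r => //; apply: le_trans (cn_iota hN _) _.
    by rewrite (_ : complex.Re `|c^-1| = (complex.Re `|c|)^-1) //;
      exact: (Normc.normcV c).
  by rewrite ler_pdivrMl //; lra.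
have [Y [Y1 Y2]] := near1_inv X8.
pose Z := Y * iota c^-1.
have dE : iota z ^+ n - Q ^+ n = iota c * (1 - iota c^-1 * X).
  rewrite mulrBr mulr1 mulrA -rmorphM mulfV // rmorph1 mul1r /c /X.
  by rewrite rmorphB rmorphXn rmorph1 opprB addrA subrK.
have zQ : GRing.comm (iota z) Q := cn_central hN z Q.
pose G := \sum_(i < n) iota z ^+ (n.-1 - i) * Q ^+ i.
have GE : iota z ^+ n - Q ^+ n = (iota z - Q) * G by rewrite subrXX_comm.
have GC : GRing.comm (iota z - Q) G.
  apply: commr_sum => i _.
  have h : GRing.comm (iota z - Q) (iota z).
    by apply: commr_sym; apply: commrB => //; exact: commr_refl.
  have h' : GRing.comm (iota z - Q) Q.
    by apply: commr_sym; apply: commrB => //; exact: commr_sym.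
  by apply: commrM; exact: commrX.
have R1 : (iota z - Q) * (G * Z) = 1.
  rewrite mulrA -GE dE /Z mulrA -(mulrA (iota c)) Y1 mulr1 -rmorphM mulfV //.
  exact: rmorph1.
have L1 : (Z * G) * (iota z - Q) = 1.
  rewrite -mulrA -GC -GE dE /Z mulrA -(mulrA Y) -rmorphM mulVf //.
  by rewrite rmorph1 mulr1.
exists (G * Z); split => //.
(* A right and a left inverse of the same element coincide. *)
have -> : G * Z = Z * G by rewrite -[LHS]mul1r -[X in X * _]L1 -mulrA R1 mulr1.
exact: L1.
Qed.

End BanachLog.

(** * The operator norm on matrices *)

Section MatrixNorm.
Variables (R : realType) (A : banachAlgType R[i]).
Implicit Types x y : A.

Definition re_norm x : R := complex.Re `|x|.

Lemma re_normE x : `|x| = (re_norm x)%:C%C.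
Proof.
rewrite /re_norm; have := normr_ge0 x; rewrite lecE.
by case: `|x| => a b /= /andP[/eqP ->].
Qed.

Lemma re_norm_ge0 x : 0 <= re_norm x.
Proof. by rewrite -ler0c -re_normE. Qed.

Lemma re_normD x y : re_norm (x + y) <= re_norm x + re_norm y.
Proof. by rewrite -lecR rmorphD /= -!re_normE ler_normD. Qed.

Lemma re_normM x y : re_norm (x * y) <= re_norm x * re_norm y.
Proof. by rewrite -lecR rmorphM /= -!re_normE banach_normM. Qed.

Lemma re_norm0 : re_norm 0 = 0.
Proof. by rewrite /re_norm normr0. Qed.

Lemma re_norm_eq0 x : re_norm x = 0 -> x = 0.
Proof. by move=> x0; apply/eqP; rewrite -normr_eq0 re_normE x0. Qed.

Lemma re_norm_scale (c : R[i]) x :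
  re_norm (c%:A * x) = complex.Re `|c| * re_norm x.
Proof.
by apply: complexI; rewrite -re_normE mulr_algl normrZ rmorphM /= -re_normE;
  case: c.
Qed.

Lemma re_norm_sum (I : Type) (r : seq I) (F : I -> A) :
  re_norm (\sum_(i <- r) F i) <= \sum_(i <- r) re_norm (F i).
Proof.
elim/big_rec2: _ => [|i a b _ ab]; first by rewrite re_norm0.
by apply: le_trans (re_normD _ _) _; rewrite lerD2l.
Qed.

Variable n : nat.
Implicit Types (M : 'M[A]_n) (v : 'cV[A]_n).

Lemma vec_norm_ge v i : re_norm (v i 0) <= vec_norm v.
Proof. exact: (le_bigmax _ (fun i => re_norm (v i 0))). Qed.

Lemma vec_norm_ge0 v : 0 <= vec_norm v.
Proof. exact: bigmax_ge_id. Qed.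

Lemma vec_norm_le v b : 0 <= b -> (forall i, re_norm (v i 0) <= b) ->
  vec_norm v <= b.
Proof. by move=> b0 vb; apply: bigmax_le => // i _; exact: vb. Qed.

(** A crude bound for the operator norm. It makes the supremum finite and turns entrywise
    convergence into convergence in norm. *)
Definition entry_sum M : R := \sum_(i < n) \sum_(j < n) re_norm (M i j).

Lemma vec_norm_mul_entries M v :
  vec_norm (M *m v) <= entry_sum M * vec_norm v.
Proof.
apply: vec_norm_le => [|i].
  by rewrite mulr_ge0 ?vec_norm_ge0 //; do 2!apply: sumr_ge0 => ? _;
    exact: re_norm_ge0.
rewrite mxE; apply: le_trans (re_norm_sum _ _) _.
apply: (@le_trans _ _ ((\sum_j re_norm (M i j)) * vec_norm v)).
  rewrite mulr_suml; apply: ler_sum => j _; apply: le_trans (re_normM _ _) _.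
  by rewrite ler_wpM2l ?re_norm_ge0 ?vec_norm_ge.
rewrite ler_wpM2r ?vec_norm_ge0 // [leRHS](bigD1 i) //= lerDl.
by do 2!apply: sumr_ge0 => ? _; exact: re_norm_ge0.
Qed.

Let unit_image M := [set vec_norm (M *m v) | v in [set v | vec_norm v <= 1]].

Let vec_norm0 : vec_norm (0 : 'cV[A]_n) = 0.
Proof.
apply/eqP; rewrite eq_le vec_norm_ge0 andbT.
by apply: vec_norm_le => // i; rewrite mxE re_norm0.
Qed.

Lemma op_norm_le M b :
  (forall v, vec_norm v <= 1 -> vec_norm (M *m v) <= b) -> op_norm M <= b.
Proof.
move=> Mb; apply: ge_sup.
  by exists (vec_norm (M *m 0)); exists 0 => //=; rewrite vec_norm0.
by move=> _ [v /= v1 <-]; exact: Mb.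
Qed.

Lemma op_norm_ge M v : vec_norm v <= 1 -> vec_norm (M *m v) <= op_norm M.
Proof.
move=> v1; apply: ub_le_sup; last by exists v.
exists (entry_sum M) => _ [w /= w1 <-].
apply: le_trans (vec_norm_mul_entries _ _) _.
rewrite -[leRHS]mulr1 ler_wpM2l //.
by do 2!apply: sumr_ge0 => ? _; exact: re_norm_ge0.
Qed.

Lemma op_norm_ge0 M : 0 <= op_norm M.
Proof.
by apply: le_trans (@op_norm_ge M 0 _); rewrite ?vec_norm_ge0 ?vec_norm0.
Qed.

Lemma vec_norm_scale (c : R[i]) v :
  vec_norm (c%:A *: v) <= complex.Re `|c| * vec_norm v.
Proof.
have c0 : 0 <= complex.Re `|c| by case: c => a b; exact: sqrtr_ge0.
apply: vec_norm_le => [|i]; first by rewrite mulr_ge0 ?vec_norm_ge0.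
by rewrite mxE re_norm_scale ler_wpM2l ?vec_norm_ge.
Qed.

Lemma mulmx_algr M (c : R[i]) v : M *m (c%:A *: v) = c%:A *: (M *m v).
Proof.
apply/matrixP => i j; rewrite !mxE mulr_sumr.
by apply: eq_bigr => k _; rewrite mxE mulrA mulr_algr [RHS]mulrA mulr_algl.
Qed.

Lemma vec_norm_mul M v : vec_norm (M *m v) <= op_norm M * vec_norm v.
Proof.
have [v0|v0] := eqVneq (vec_norm v) 0.
  by have := vec_norm_mul_entries M v; rewrite v0 !mulr0.
have {}v0 : 0 < vec_norm v by rewrite lt_def v0 vec_norm_ge0.
pose c := ((vec_norm v)%:C)%C;
  have c0 : c != 0 by rewrite gt_eqF // ltcE /= eqxx.
pose w := c^-1%:A *: v.
have cw : v = c%:A *: w by rewrite /w scalerA mulr_algl scalerA mulfV //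
  !scale1r.
rewrite {1}cw mulmx_algr mulrC; apply: le_trans (vec_norm_scale _ _) _.
rewrite Re_norm_real ?vec_norm_ge0 // ler_wpM2l ?vec_norm_ge0 //.
apply: op_norm_ge; apply: le_trans (vec_norm_scale _ _) _.
by rewrite -[c^-1]fmorphV Re_norm_real ?invr_ge0 ?vec_norm_ge0 // mulVf //
  gt_eqF.
Qed.

Lemma re_norm_entry M i j : re_norm (M i j) <= op_norm M.
Proof.
have -> : M i j = (M *m delta_mx j 0 : 'cV_n) i 0.
  rewrite mxE (bigD1 j) //= mxE !eqxx mulr1 big1 ?addr0 // => k kj.
  by rewrite mxE (negPf kj) mulr0.
apply: le_trans (vec_norm_ge _ _) (op_norm_ge _ _).
apply: vec_norm_le => // k; rewrite mxE eqxx andbT.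
case: (k == j); last by rewrite re_norm0.
by rewrite /re_norm (_ : `|_| = 1) //; exact: banach_norm1.
Qed.

Lemma op_norm_entries M : op_norm M <= entry_sum M.
Proof.
apply: op_norm_le => v v1; apply: le_trans (vec_norm_mul_entries _ _) _.
rewrite -[leRHS]mulr1 ler_wpM2l //.
by do 2!apply: sumr_ge0 => ? _; exact: re_norm_ge0.
Qed.

Lemma banach_complete (u : nat -> A) (b : nat -> R) :
  b m @[m --> \oo] --> 0 ->
  (forall k m, (k <= m)%N -> re_norm (u m - u k) <= b k) ->
  exists l, re_norm (l - u m) @[m --> \oo] --> 0.
Proof.
move=> b0 ub.
have : cvg (u @ \oo).
  apply/cauchy_cvgP/cauchy_exP => e e0.
  have [re0 eE] : 0 < complex.Re e /\ e = (complex.Re e)%:C%C.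
    by move: e0; rewrite ltcE; case: e => a c /= /andP[/eqP -> ?].
  have /cvgrPdist_lt/(_ _ re0) [k _ kb] := b0.
  exists (u k); exists k => // m /= km.
  rewrite -ball_normE /= -normrN opprB eE re_normE ltcR.
  apply: le_lt_trans (ub _ _ km) _; have := kb k (leqnn k).
  by rewrite sub0r normrN; apply: le_lt_trans; exact: ler_norm.
move=> /cvg_ex[l ul]; exists l; apply/cvgrPdist_lt => e e0.
have e0C : 0 < e%:C%C :> R[i] by rewrite ltcE /= eqxx.
move/cvgrPdist_lt/(_ _ e0C) : ul; apply: filterS => m.
by rewrite re_normE ltcR sub0r normrN ger0_norm ?re_norm_ge0.
Qed.

Definition mx_iota : {rmorphism R[i] -> 'M[A]_n} := @scalar_mx A n \o in_alg A.

Lemma op_norm_complete : complete_norm mx_iota (@op_norm R A n).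
Proof.
split.
- exact: op_norm_ge0.
- move=> M M0; apply/matrixP => i j; rewrite mxE; apply: re_norm_eq0.
  by apply/eqP; rewrite eq_le re_norm_ge0 andbT -M0 re_norm_entry.
- move=> M M'; apply: op_norm_le => v v1; rewrite mulmxDl.
  apply: (@le_trans _ _ (vec_norm (M *m v) + vec_norm (M' *m v))).
    apply: vec_norm_le => [|i]; first by rewrite addr_ge0 ?vec_norm_ge0.
    rewrite mxE; apply: le_trans (re_normD _ _) _.
    by rewrite lerD ?vec_norm_ge.
  by rewrite lerD ?op_norm_ge.
- move=> M M'; apply: op_norm_le => v v1; rewrite -mulmxA.
  apply: le_trans (vec_norm_mul _ _) _.
  by rewrite ler_wpM2l ?op_norm_ge0 ?op_norm_ge.
- by apply: op_norm_le => v v1; rewrite mul1mx.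
- move=> c; apply: op_norm_le => v v1; rewrite mul_scalar_mx.
  apply: le_trans (vec_norm_scale _ _) _; rewrite -[leRHS]mulr1 ler_wpM2l //.
  by case: c => a b; exact: sqrtr_ge0.
- move=> c M; rewrite /GRing.comm; apply/matrixP => i j.
  have -> : mx_iota c * M = c%:A *: M by exact: mul_scalar_mx.
  rewrite !mxE (bigD1 j) //= big1 => [|k kj];
    last by rewrite mxE (negPf kj) mulr0.
  by rewrite mxE eqxx mulr1n addr0 mulr_algr mulr_algl.
(* Entries are dominated by the norm, so they have limits; the matrix of limits is the limit in norm
   because [entry_sum] dominates [op_norm]. *)
- move=> u b b0 ub.
  have /choice[l lP] (ij : 'I_n * 'I_n) :
      exists l, re_norm (l - u m ij.1 ij.2) @[m --> \oo] --> 0.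
    apply: (banach_complete b0) => k m km.
    have -> : u m ij.1 ij.2 - u k ij.1 ij.2 = (u m - u k) ij.1 ij.2 by rewrite
      !mxE.
    exact: le_trans (re_norm_entry _ _ _) (ub _ _ km).
  pose L := \matrix_(i, j) l (i, j); exists L.
  have s0 : entry_sum (L - u m) @[m --> \oo] --> 0.
    rewrite [X in _ --> X](_ : 0 = \sum_(i < n) \sum_(j < n) (0 : R));
      last first.
      by rewrite big1 // => i _; rewrite big1.
    apply: cvg_big => [|i _]; first exact: add_continuous.
    apply: cvg_big => [|j _]; first exact: add_continuous.
    by under eq_fun do rewrite !mxE; exact: (lP (i, j)).
  apply: (squeeze_cvgr _ (cvg_cst 0) s0).
  by apply: nearW => m; rewrite op_norm_ge0 op_norm_entries.
Qed.

(** [mx_exp] picks some limit of the series, with default 0; uniqueness of limits identifies the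
    pick. *)
Lemma mx_exp_eq (M E : 'M[A]_n) : has_exp mx_iota (@op_norm R A n) M E ->
  mx_exp M = E.
Proof.
have partE : mx_exp_partial M = alg_exp_sum mx_iota M.
  by apply/funext => m; apply: eq_bigr => k _; rewrite -mul_scalar_mx.
move=> ME; apply: xget_unique; first by rewrite /= partE.
by move=> F; rewrite /= partE => FE; exact: (tends_uniq op_norm_complete FE ME).
Qed.

End MatrixNorm.

(** * The cyclic permutation matrix *)

Section Cyclic.
Variables (T : pzRingType) (n : nat).

(** With this orientation the matrix sends [v] to its cyclic shift, so [(z ^ i)_i] is an eigenvector
    for each [z] with [z ^ n = 1]. *)
Definition cyc_mx : 'M[T]_n := \matrix_(i, j) (j == ordS i)%:R.

Definition cyc_mx_inv : 'M[T]_n := \matrix_(i, j) (i == ordS j)%:R.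

Lemma mul_cyc_mx m (M : 'M[T]_(n, m)) i j : (cyc_mx *m M) i j = M (ordS i) j.
Proof.
rewrite mxE (bigD1 (ordS i)) //= mxE eqxx mul1r big1 ?addr0 // => k ki.
by rewrite mxE (negPf ki) mul0r.
Qed.

Lemma mul_cyc_mx_inv m (M : 'M[T]_(n, m)) i j :
  (cyc_mx_inv *m M) i j = M (ord_pred i) j.
Proof.
rewrite mxE (bigD1 (ord_pred i)) //= mxE ord_predK eqxx mul1r.
rewrite big1 ?addr0 // => k ki; rewrite mxE -{1}(ord_predK i).
by rewrite (inj_eq (@ordS_inj n)) eq_sym (negPf ki) mul0r.
Qed.

Lemma cyc_mxK : cyc_mx * cyc_mx_inv = 1.
Proof.
apply/matrixP => i j; rewrite mul_cyc_mx !mxE (inj_eq (@ordS_inj n)) //.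
Qed.

Lemma cyc_mx_invK : cyc_mx_inv * cyc_mx = 1.
Proof.
by apply/matrixP => i j; rewrite mul_cyc_mx_inv !mxE ord_predK eq_sym.
Qed.

Lemma val_iter_ordS k (i : 'I_n) : iter k (@ordS n) i = ((i + k) %% n)%N :> nat.
Proof.
elim: k => [|k IH]; first by rewrite addn0 modn_small.
by rewrite iterS /= IH -addn1 modnDml addn1 addnS.
Qed.

Lemma cyc_mx_expn : cyc_mx ^+ n = 1.
Proof.
have cycX k i j : (cyc_mx ^+ k) i j = (j == iter k (@ordS n) i)%:R.
  elim: k i => [|k IH] i; first by rewrite expr0 mxE eq_sym.
  by rewrite exprS mul_cyc_mx IH iterSr.
apply/matrixP => i j; rewrite cycX mxE (_ : iter _ _ _ = i) 1?eq_sym //.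
by apply: val_inj; rewrite /= val_iter_ordS modnDr modn_small.
Qed.

Lemma cyc_mx_inv_expn : cyc_mx_inv ^+ n = 1.
Proof.
have /(exprMn_comm n) : GRing.comm cyc_mx_inv cyc_mx.
  by rewrite /GRing.comm cyc_mxK cyc_mx_invK.
by rewrite cyc_mx_invK expr1n cyc_mx_expn mulr1.
Qed.

End Cyclic.

(** * Units on the diagonal and the diagonal conjugator *)

Section DiagonalUnits.
Variable T : pzRingType.

Lemma two_sided_unitM (x y : T) :
  two_sided_unit x -> two_sided_unit y -> two_sided_unit (x * y).
Proof.
move=> [x' [xx' x'x]] [y' [yy' y'y]]; exists (y' * x'); split.
  by rewrite mulrA -(mulrA x) yy' mulr1.
by rewrite mulrA -(mulrA y') x'x mulr1.
Qed.

Lemma two_sided_unit_prod (a : nat -> T) k :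
  (forall i, (i < k)%N -> two_sided_unit (a i)) ->
  two_sided_unit (\prod_(0 <= i < k) a i).
Proof.
move=> au; rewrite big_nat; apply: big_ind => //; last exact: two_sided_unitM.
by exists 1; rewrite mulr1.
Qed.

(** Induction along the diagonal, proving also that the inverse [N] is upper triangular. Once the
    earlier columns of [N] vanish below the diagonal, [N i i] is a left inverse of [M i i]; the
    product condition supplies a right one. *)
Lemma upper_triangular_diag_unit n (M N : 'M[T]_n) :
  upper_triangular M -> N *m M = 1%:M -> \prod_(i < n) M i i = 1 ->
  forall i, two_sided_unit (M i i).
Proof.
case: n M N => [|n] M N; first by move=> _ _ _ [].
move=> Mup NM prodM.
pose a k : T := M (inord k) (inord k).
have aE (i : 'I_n.+1) : a i = M i i by rewrite /a inord_val.
have prodA : \prod_(0 <= k < n.+1) a k = 1.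
  by rewrite big_mkord -[RHS]prodM; apply: eq_bigr.
suff key k (i : 'I_n.+1) : (i < k)%N ->
    two_sided_unit (M i i) /\ forall l : 'I_n.+1, (i < l)%N -> N l i = 0.
  by move=> i; have [] := key n.+1 i (ltn_ord i).
elim: k i => // k IH i ik.
have NMi (l : 'I_n.+1) : (i <= l)%N -> N l i * M i i = (l == i)%:R.
  move=> il; have := congr1 (fun X : 'M[T]_(n.+1) => X l i) NM.
  rewrite !mxE (bigD1 i) //= big1 ?addr0 // => j ji.
  have [lt|lt|/val_inj e] := ltngtP j i; last by rewrite e eqxx in ji.
    have [_ ->] := IH j (leq_trans lt ik); first by rewrite mul0r.
    exact: leq_trans lt il.
  by rewrite Mup // mulr0.
have Nii : N i i * M i i = 1 by rewrite NMi // eqxx.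
(* Write the product as [p (M i i) r = 1] with [p] a product of earlier diagonal entries. As [p] is
   a unit, [M i i * r = p^-1], so [r * p] is a right inverse. *)
have [y My] : exists y, M i i * y = 1.
  have [|u [pu up]] := @two_sided_unit_prod a i.
    move=> j ji; have jn : (j < n.+1)%N by exact: ltn_trans ji (ltn_ord i).
    have /= -> := aE (Ordinal jn).
    by have [] := IH (Ordinal jn) (leq_trans ji ik).
  move: prodA; rewrite (@big_cat_nat _ _ _ i) //=; last exact: ltnW.
  rewrite [\prod_(i <= _ < n.+1) _]big_ltn // aE.
  set p := \prod_(_ <= _ < _) _ in pu up *; set r := \prod_(_ <= _ < _) _.
  move=> pMr; exists (r * p); rewrite mulrA.
  by rewrite -[M i i * r]mul1r -up -(mulrA u) pMr mulr1 up.
have yN : y = N i i by rewrite -[y]mul1r -Nii -mulrA My mulr1.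
split; first by exists y; split => //; rewrite yN.
move=> l il; have := NMi l (ltnW il).
rewrite (_ : l == i = false); last by apply/eqP => e; rewrite e ltnn in il.
by move=> NM0; rewrite -[N l i]mulr1 -My mulrA NM0 mul0r.
Qed.

Lemma diag_mxM_entry n (d : 'rV[T]_n) (M : 'M[T]_n) i j :
  (diag_mx d * M) i j = d 0 i * M i j.
Proof. by rewrite -[_ * _]/(diag_mx d *m M) mul_diag_mx mxE. Qed.

(* [S = diag (q_i)] with [q_i = (a_0 ... a_(i-1))^-1]; the wrap-around entry is
   where the hypothesis on the product of the diagonal is used. *)
Lemma diag_cyc_factor n (a : 'I_n -> T) :
  (forall i, two_sided_unit (a i)) -> \prod_(i < n) a i = 1 ->
  exists S S' : 'M[T]_n, [/\ S * S' = 1, S' * S = 1 &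
    S * cyc_mx_inv T n * S' * diag_mx (\row_i a i) = cyc_mx_inv T n].
Proof.
case: n a => [|n] a au prod_a.
  by exists 1, 1; rewrite mulr1; split => //; apply/matrixP => -[].
pose b k := a (inord k).
have bE (i : 'I_n.+1) : b i = a i by rewrite /b inord_val.
pose p k := \prod_(0 <= j < k) b j.
have /choice[q qP] k : two_sided_unit (p k).
  by apply: two_sided_unit_prod => i _; exact: au.
have pq k : p k * q k = 1 by case: (qP k).
have qp k : q k * p k = 1 by case: (qP k).
have pn : p n.+1 = 1.
  by rewrite /p big_mkord -[RHS]prod_a; apply: eq_bigr.
pose S := diag_mx (\row_(i < n.+1) q i);
  pose S' := diag_mx (\row_(i < n.+1) p i).
have SS' : S * S' = 1.
  apply/matrixP => i j; rewrite diag_mxM_entry !mxE.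
  by have [->|] := eqVneq i j; rewrite ?mulr1n ?mulr0n ?mulr0 ?pq ?qp.
have S'S : S' * S = 1.
  apply/matrixP => i j; rewrite diag_mxM_entry !mxE.
  by have [->|] := eqVneq i j; rewrite ?mulr1n ?mulr0n ?mulr0 ?pq ?qp.
exists S, S'; split => //.
(* Cancelling [S] leaves [C S' D = S' C], with [C] the inverse cyclic matrix and [D] the diagonal of
   [a]. In column [j] the only nonzero entries are [p_j a_j = p_(j+1)] and [p] at the cyclic
   successor of [j]. *)
rewrite -!mulrA -[RHS]mul1r -SS' -mulrA; congr (_ * _).
apply/matrixP => i j; rewrite mul_cyc_mx_inv !diag_mxM_entry !mxE.
rewrite -(inj_eq (@ordS_inj n.+1)) ord_predK.
have [->|] := eqVneq i (ordS j); last by rewrite mulr0n !mulr0.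
rewrite ordSK mulr1n mulr1 -bE -[LHS](big_nat_recr j) //=.
rewrite -/(p j.+1).
have [->|jn] := eqVneq j.+1 n.+1; first by rewrite modnn pn /p big_geq.
by rewrite modn_small // ltn_neqAle jn ltn_ord.
Qed.

End DiagonalUnits.

(** * Shrinking the off-diagonal part by conjugation *)

Section TriangularScaling.
Variables (R : realType) (A : banachAlgType R[i]) (n : nat).
Implicit Types M : 'M[A]_n.

Lemma scaling_conj M (f : 'I_n -> R[i]) : (forall i, f i != 0) ->
  exists T T' : 'M[A]_n, [/\ T * T' = 1, T' * T = 1 &
    M = T * (\matrix_(i, j) (((f i)^-1 * f j)%:A * M i j)) * T'].
Proof.
move=> f0; pose T : 'M[A]_n := diag_mx (\row_i (f i)%:A).
pose T' : 'M[A]_n := diag_mx (\row_i (f i)^-1%:A).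
exists T, T'; split.
- apply/matrixP => i j; rewrite diag_mxM_entry !mxE.
  have [->|_] := eqVneq i j; last by rewrite !mulr0n mulr0.
  by rewrite !mulr1n mulr_algl scalerA mulfV // scale1r.
- apply/matrixP => i j; rewrite diag_mxM_entry !mxE.
  have [->|_] := eqVneq i j; last by rewrite !mulr0n mulr0.
  by rewrite !mulr1n mulr_algl scalerA mulVf // scale1r.
rewrite -mulrA; apply/matrixP => i j; rewrite diag_mxM_entry.
rewrite -[(_ * T')]/(_ *m T') mul_mx_diag !mxE.
rewrite mulr_algr !mulr_algl !scalerA -[LHS]scale1r; congr (_ *: _).
by field; rewrite !f0.
Qed.

(** Conjugation by the powers [d^i] (upper case) or [d^-i] (lower case) multiplies the entry
    [(i, j)] on the nonzero side by [d^|i - j|], at most [d] off the diagonal. *)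
Lemma triangular_scaling M (d : R) : 0 < d <= 1 ->
  upper_triangular M \/ lower_triangular M ->
  exists T T' M' : 'M[A]_n, [/\ T * T' = 1, T' * T = 1, M = T * M' * T',
    forall i, M' i i = M i i &
    forall i j, i != j -> re_norm (M' i j) <= d * re_norm (M i j)].
Proof.
move=> /andP[d0 d1] tri.
have c0 : d%:C%C != 0 :> R[i] by rewrite gt_eqF // ltcE /= eqxx.
have [f [f0 fM]] : exists f : 'I_n -> R[i], (forall i, f i != 0) /\
    forall i j, i != j -> M i j != 0 ->
      exists k, (f i)^-1 * f j = ((d ^+ k.+1)%:C)%C.
  have dX k : (d ^+ k)%:C%C = d%:C%C ^+ k :> R[i] by rewrite rmorphXn.
  case: tri => tri.
    exists (fun i => d%:C%C ^+ i); split=> [i|i j ij Mij];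
      first exact: expf_neq0.
    have [lt|lt|/val_inj e] := ltngtP i j; last by rewrite e eqxx in ij.
      exists (j - i.+1)%N; rewrite dX -subSn // subSS mulrC.
      by rewrite expfB_cond ?(negPf c0) // ltnW.
    by rewrite tri ?eqxx in Mij.
  exists (fun i => d%:C%C ^- i); split=> [i|i j ij Mij].
    by rewrite invr_neq0 ?expf_neq0.
  have [lt|lt|/val_inj e] := ltngtP i j; last by rewrite e eqxx in ij.
    by rewrite tri ?eqxx in Mij.
  exists (i - j.+1)%N; rewrite dX -subSn // subSS invrK.
  by rewrite expfB_cond ?(negPf c0) // ltnW.
have [T [T' [TT' T'T ME]]] := scaling_conj M f0.
exists T, T', (\matrix_(i, j) (((f i)^-1 * f j)%:A * M i j)); split => //.
  by move=> i; rewrite mxE mulVf // scale1r mul1r.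
move=> i j ij; rewrite mxE.
have [->|Mij] := eqVneq (M i j) 0; first by rewrite mulr0 re_norm0 mulr0.
have [k ->] := fM i j ij Mij; rewrite re_norm_scale ler_wpM2r ?re_norm_ge0 //.
rewrite Re_norm_real ?exprn_ge0 ?(ltW d0) // exprS -[leRHS]mulr1.
by rewrite ler_wpM2l ?(ltW d0) // exprn_ile1 ?(ltW d0).
Qed.

End TriangularScaling.

(** * Perturbed powers and spectra *)

(** The constant [K] depends on [C] and [k] only, so it can be fixed before the size of [E] is
    chosen. [E] and [C] may fail to commute, hence the induction on [k]. *)
Lemma expr_perturbation (R : realType) (T : pzRingType)
    (iota : {rmorphism R[i] -> T}) (N : T -> R) (C : T) k :
  complete_norm iota N ->
  exists2 K : R, 0 <= K &
    forall E, N E <= 1 -> N ((C + E) ^+ k - C ^+ k) <= K * N E.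
Proof.
move=> hN; elim: k => [|k [K K0 KE]].
  by exists 0 => // E _; rewrite subrr (cn0 hN) mul0r.
exists ((N C + 1) * K + N (C ^+ k)).
  by rewrite addr_ge0 ?mulr_ge0 ?addr_ge0 ?(cn_ge0 hN).
move=> E E1; rewrite !exprS.
have -> : (C + E) * (C + E) ^+ k - C * C ^+ k
    = (C + E) * ((C + E) ^+ k - C ^+ k) + E * C ^+ k.
  by rewrite mulrBr -[RHS]addrA; congr (_ + _); rewrite mulrDl opprD subrK.
apply: le_trans (cnD hN _ _) _; rewrite [leRHS]mulrDl; apply: lerD; last first.
  by rewrite mulrC; apply: le_trans (cnM hN _ _) _; rewrite mulrC.
apply: le_trans (cnM hN _ _) _; rewrite -mulrA.
apply: ler_pM; rewrite ?(cn_ge0 hN) ?KE //.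
by apply: le_trans (cnD hN _ _) _; rewrite lerD2l.
Qed.

Lemma mulr_conj (T : pzRingType) (U V X Y : T) : V * U = 1 ->
  (U * X * V) * (U * Y * V) = U * (X * Y) * V.
Proof. by move=> VU; rewrite !mulrA -(mulrA _ V U) VU mulr1. Qed.

Section Spectrum.
Variables (R : realType) (A : banachAlgType R[i]) (n : nat).
Implicit Types M : 'M[A]_n.

Lemma mx_spectrum_conj M (U V : 'M[A]_n) : U * V = 1 -> V * U = 1 ->
  mx_spectrum (U * M * V) = mx_spectrum M.
Proof.
move=> UV VU.
have scC (z : R[i]) (X : 'M[A]_n) : (z%:A)%:M * X = X * (z%:A)%:M.
  exact: cn_central (op_norm_complete A n) z X.
apply/seteqP; split => z /= h [Y [Y1 Y2]]; apply: h.
  have -> : (z%:A)%:M - U * M * V = U * ((z%:A)%:M - M) * V.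
    rewrite mulrBr mulrBl; congr (_ - _).
    by rewrite -scC -mulrA UV mulr1.
  exists (U * Y * V); split.
    by rewrite [LHS](mulr_conj _ _ VU) [_ * Y]Y1 mulr1.
  by rewrite [LHS](mulr_conj _ _ VU) [Y * _]Y2 mulr1.
have e : (z%:A)%:M - M = V * ((z%:A)%:M - U * M * V) * U.
  rewrite mulrBr mulrBl; congr (_ - _).
    by rewrite -scC -mulrA VU mulr1.
  by rewrite !mulrA VU mul1r -mulrA VU mulr1.
rewrite e; exists (V * Y * U); split.
  by rewrite [LHS](mulr_conj _ _ UV) [_ * Y]Y1 mulr1.
by rewrite [LHS](mulr_conj _ _ UV) [Y * _]Y2 mulr1.
Qed.

Lemma mx_spectrum_near_roots M (e : R) : (0 < n)%N -> 0 <= e ->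
  8 * op_norm (M ^+ n - 1) <= e ^+ n ->
  mx_spectrum M `<=` roots_of_unity_nbhd R n e.
Proof.
move=> n0 e0 Me z /= zM; apply: near_unity_root => //.
rewrite leNgt; apply/negP => lt; apply: zM.
exact: (resolvent_near_roots (op_norm_complete A n) n0 (le_lt_trans Me lt)).
Qed.

(** One inclusion is [mx_spectrum_near_roots] with radius 0. For the other, [(z ^ i)_i] is an
    eigenvector, with [z ^ n = 1] absorbing the wrap-around, and its entry 1 at index 0 prevents
    [z - P] from having a left inverse. *)
Lemma mx_spectrum_cyc : (0 < n)%N ->
  mx_spectrum (cyc_mx A n) = roots_of_unity R n.
Proof.
move=> n0; have hN := op_norm_complete A n; apply/seteqP; split => z /= zP.
  have : mx_spectrum (cyc_mx A n) `<=` roots_of_unity_nbhd R n 0.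
    apply: mx_spectrum_near_roots => //.
    by rewrite cyc_mx_expn subrr (cn0 hN) mulr0 exprn_ge0.
  move=> /(_ z zP)[y yn]; rewrite normr_le0 subr_eq0 => /eqP ->; exact: yn.
move=> [Y [_ YP]].
pose v : 'cV[A]_n := \col_i (z ^+ i)%:A.
have Pv : ((z%:A)%:M - cyc_mx A n) *m v = 0.
  apply/matrixP => i j; rewrite mulmxBl mxE [X in _ + X]mxE mul_cyc_mx.
  rewrite mul_scalar_mx !mxE /= expr_mod // mulr_algl scalerA -exprS.
  by rewrite subrr.
have v0 : v = 0 by rewrite -[v]mul1mx -YP -mulmxA Pv mulmx0.
have /eqP := congr1 (fun w : 'cV[A]_n => w (Ordinal n0) 0) v0.
by rewrite !mxE /= expr0 scale1r oner_eq0.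
Qed.

End Spectrum.

(** * The factorization *)

Theorem theorem1p5 (R : realType) (𝒜 : banachAlgType R[i]) (n : nat)
    (hn : (2 <= n)%N) (A : 'M[𝒜]_n)
    (hA : mx_GL A)
    (htri : upper_triangular A \/
      (lower_triangular A /\ forall i : 'I_n, two_sided_unit (A i i)))
    (hdiag : \prod_(i < n) A i i = 1) :
  forall eps : R, 0 < eps ->
  exists B1 B2 : 'M[𝒜]_n,
    [/\ A = mx_exp B1 *m mx_exp B2,
        mx_spectrum (mx_exp B1) = roots_of_unity R n &
        mx_spectrum (mx_exp B2) `<=` roots_of_unity_nbhd R n eps].
Proof.
move=> eps eps0; have n0 : (0 < n)%N by exact: ltnW.
have diagU i : two_sided_unit (A i i).
  case: htri => [up|[_ //]]; have [N [_ NA]] := hA.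
  exact: upper_triangular_diag_unit NA hdiag i.
have tri : upper_triangular A \/ lower_triangular A.
  by case: htri => [|[]]; [left|right].
have hN := op_norm_complete 𝒜 n; set N := @op_norm R 𝒜 n in hN.
have [S [S' [SS' S'S SCS]]] := diag_cyc_factor diagU hdiag.
set P := cyc_mx 𝒜 n; set C := cyc_mx_inv 𝒜 n in SCS; set D := diag_mx _ in SCS.
have [K K0 KP] := expr_perturbation C n hN.
pose U := S * C * S'; pose s := entry_sum A; pose k := N U * s.
have s0 : 0 <= s.
  by do 2!apply: sumr_ge0 => ? _; exact: re_norm_ge0.
have k0 : 0 <= k by rewrite mulr_ge0 ?(cn_ge0 hN).
(* The bound [1/8] is for the logarithm of [Q], and [eps ^+ n / 8] for its spectrum. *)
pose eta := Num.min (8^-1) (eps ^+ n / 8).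
have eta0 : 0 < eta by rewrite lt_min invr_gt0 ltr0n divr_gt0 ?exprn_gt0.
have eta8 : eta <= 8^-1 by rewrite ge_min lexx.
have etan : 8 * eta <= eps ^+ n.
  by rewrite mulrC -ler_pdivlMr // ge_min lexx orbT.
(* This choice gives both [d * k <= eta], which keeps [E] in the unit ball, and
   [K * (d * k) <= eta], which bounds [Q ^+ n - 1]. *)
pose d := eta / ((1 + k) * (1 + K)).
have den1 : 1 <= (1 + k) * (1 + K) by have := mulr_ge0 k0 K0; nra.
have den0 : 0 < (1 + k) * (1 + K) by lra.
have d0 : 0 < d by rewrite divr_gt0.
have dE : d * ((1 + k) * (1 + K)) = eta by rewrite divfK // gt_eqF.
have dk : d * k <= eta /\ K * (d * k) <= eta.
  have h1 := mulr_ge0 (ltW d0) K0; have h2 := mulr_ge0 (ltW d0) k0.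
  have h3 := mulr_ge0 h2 K0; rewrite -dE; split; nra.
have d01 : 0 < d <= 1 by rewrite d0 ler_pdivrMr // mul1r;
  apply: le_trans den1; lra.
have [T [T' [A' [TT' T'T AE A'd A's]]]] := triangular_scaling d01 tri.
pose E := U * (A' - D).
(* [SCS] says [U * D = C], so only the off-diagonal part of [A'] contributes to [E]. *)
have QE : U * A' = C + E by rewrite /E mulrBr SCS addrCA subrr addr0.
have NE : N E <= d * k.
  apply: le_trans (cnM hN _ _) _; rewrite /k mulrCA ler_wpM2l ?(cn_ge0 hN) //.
  apply: le_trans (op_norm_entries _) _; rewrite mulr_sumr;
    apply: ler_sum => i _.
  rewrite mulr_sumr; apply: ler_sum => j _; rewrite !mxE.
  have [<-|ij] := eqVneq i j; last by rewrite mulr0n subr0 A's.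
  by rewrite mulr1n A'd subrr re_norm0 mulr_ge0 ?re_norm_ge0 // ltW.
pose Q := C + E.
have NQ : N (Q ^+ n - 1) <= eta.
  rewrite -(cyc_mx_inv_expn 𝒜 n); apply: le_trans (KP _ _) _; first lra.
  by apply: le_trans (ler_wpM2l K0 NE) _; case: dk.
have [L1 L1P _] := log_root_of_1 hN n0 (cyc_mx_expn 𝒜 n).
have [L2 L2Q] : exists L, has_exp (mx_iota 𝒜 n) N L Q.
  by apply: (log_near_root_of_1 hN n0); lra.
(* Since [U] has inverse [S P S'], [A = T A' T' = T (S P S') Q T' = (V P V') (T Q T')]. *)
pose V := T * S; pose V' := S' * T'.
have VV' : V * V' = 1 by rewrite /V /V' mulrA -(mulrA T) SS' mulr1.
have V'V : V' * V = 1 by rewrite /V /V' mulrA -(mulrA S') T'T mulr1.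
exists (V * L1 * V'), (T * L2 * T').
rewrite (mx_exp_eq (has_exp_conj hN VV' V'V L1P)).
rewrite (mx_exp_eq (has_exp_conj hN TT' T'T L2Q)).
rewrite !mx_spectrum_conj //; split; last 2 first.
- exact: mx_spectrum_cyc.
- apply: mx_spectrum_near_roots (ltW eps0) _ => //.
  by apply: le_trans etan; rewrite ler_pM2l.
rewrite AE -[RHS]/(_ * _) /V /V' /Q -QE.
have -> : T * S * P * (S' * T') = T * (S * P * S') * T' by rewrite !mulrA.
rewrite (mulr_conj _ _ T'T); congr (_ * _ * _).
rewrite /U mulrA (mulr_conj _ _ S'S).
by rewrite [P * C]cyc_mxK mulr1 SS' mul1r.
Qed.
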